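(* There exists an absolute constant $b>0$ such that for every real $K\ge 2.1$ there is $n_0=n_0(K)$ such that for all integers $n\ge n_0$, $$f(n,K)\ \ge\ n^{1-b/K}.$$
   Context: All graphs are finite and simple. For a graph $G$, $\Delta(G)$ and $\delta(G)$ denote its maximum and minimum degree, and $G[U]$ denotes the subgraph of $G$ induced on $U\subseteq V(G)$. For a real $c\ge 1$, a graph $G$ is $c$-nearly regular if $\Delta(G)\le c\cdot\delta(G)$. Define $f(G,c)=\max\{|U| : U\subseteq V(G),\ G[U]\text{ is } c\text{-nearly regular}\}$ and $f(n,c)=\min\{f(G,c): |V(G)|=n\}$. *)

(* Defs.v *)
From HB Require Import structures.
From mathcomp Require Import all_boot all_order all_algebra.
From mathcomp Require Import reals.

Set Implicit Arguments.
Unset Strict Implicit.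
Unset Printing Implicit Defensive.

Import Order.TTheory GRing.Theory Num.Theory.

Definition simple_adj (T : finType) (e : {ffun T -> {ffun T -> bool}}) : bool :=
  [forall x, ~~ e x x] && [forall x, forall y, e x y == e y x].

Record sgraph (T : finType) : Type := SGraph {
  adj :> {ffun T -> {ffun T -> bool}};
  adj_simple : simple_adj adj }.

HB.instance Definition _ (T : finType) := [isSub for @adj T].
HB.instance Definition _ (T : finType) := [Finite of sgraph T by <:].

Definition degree (T : finType) (G : sgraph T) (x : T) : nat :=
  #|[set y | G x y]|.

Definition max_degree (T : finType) (G : sgraph T) : nat :=
  \max_(x : T) degree G x.

(* Degrees are smaller than #|T|, so the default value #|T| never wins on a
   nonempty graph; the graph without vertices gets minimum degree 0. *)
Definition min_degree (T : finType) (G : sgraph T) : nat :=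
  \big[minn/#|T|]_(x : T) degree G x.

Lemma induced_simple (T : finType) (G : sgraph T) (U : {set T}) :
  simple_adj [ffun x : {x : T | x \in U} =>
               [ffun y : {x : T | x \in U} => G (val x) (val y)]].
Proof.
have /andP[/forallP irrG /forallP symG] := adj_simple G.
apply/andP; split; apply/forallP => x; first by rewrite !ffunE irrG.
by apply/forallP => y; rewrite !ffunE; apply: (forallP (symG _)).
Qed.

Definition induced_sgraph (T : finType) (G : sgraph T) (U : {set T}) :
  sgraph {x : T | x \in U} := SGraph (induced_simple G U).

Definition nearly_regular (R : realType) (c : R) (T : finType) (G : sgraph T) :
  bool := ((max_degree G)%:R <= c * (min_degree G)%:R)%R.

Definition max_nearly_regular (R : realType) (T : finType) (G : sgraph T)
  (c : R) : nat :=
  \max_(U : {set T} | nearly_regular c (induced_sgraph G U)) #|U|.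

(* Every n-vertex graph is isomorphic to one on 'I_n. The default value n is
   harmless: there is always a graph on 'I_n, and max_nearly_regular G c <= n. *)
Definition min_max_nearly_regular (R : realType) (n : nat) (c : R) : nat :=
  \big[minn/n]_(G : sgraph 'I_n) max_nearly_regular G c.

(* Main.v *)
(* For K below b a single vertex suffices, so K is large.  In a graph with n
   vertices and average degree d, delete the at most 8n/K vertices of degree
   above Kd/8.  If at least half of the edges survive, deleting vertices of
   degree below d/8 leaves a K-nearly regular graph on at least n/K vertices.
   Otherwise repeat: each round halves the number of edges, so after about
   2 log_2 n rounds there are none left, while (1 - 8/K)^(2 log_2 n) n
   = n^(1 - O(1/K)) vertices remain. *)
Require Import Defs.
From HB Require Import structures.
From mathcomp Require Import all_boot all_order all_algebra.
From mathcomp Require Import all_classical all_reals all_analysis.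
From mathcomp Require Import zify lra.

Set Implicit Arguments.
Unset Strict Implicit.
Unset Printing Implicit Defensive.

Import Order.TTheory GRing.Theory Num.Theory.
Local Open Scope ring_scope.

(** * Degree sums inside vertex subsets *)

Section DegreesInSubsets.
Local Open Scope nat_scope.
Variables (T : finType) (G : sgraph T).
Implicit Types (U V W : {set T}) (x y : T).

Definition deg_in W x : nat := #|[set y in W | G x y]|.

(** Twice the number of edges of the subgraph induced on [W]. *)
Definition degree_sum W : nat := \sum_(x in W) deg_in W x.

Lemma adj_irr x : G x x = false.
Proof. by have /andP[/forallP/(_ x)/negbTE] := adj_simple G. Qed.

Lemma adj_sym x y : G x y = G y x.
Proof. by have /andP[_ /forallP/(_ x)/forallP/(_ y)/eqP] := adj_simple G. Qed.

Lemma deg_inE W x : deg_in W x = \sum_(y in W) (G x y : nat).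
Proof.
rewrite /deg_in -sum1_card big_mkcond [RHS]big_mkcond /=.
by apply: eq_bigr => y _; rewrite inE; case: (y \in W); case: (G x y).
Qed.

Lemma deg_inS U W x : W \subset U -> deg_in W x <= deg_in U x.
Proof.
move=> /fintype.subsetP sWU; apply/subset_leq_card/fintype.subsetP => y.
by rewrite !inE => /andP[/sWU->].
Qed.

(** Each edge at [x] is counted once at [x] and once at its other end. *)
Lemma degree_sumD1 W x :
  x \in W -> degree_sum W = degree_sum (W :\ x) + (deg_in W x).*2.
Proof.
move=> xW; rewrite /degree_sum (big_setD1 x) //=.
under eq_bigr => y _ do rewrite deg_inE (big_setD1 x) //= -deg_inE.
rewrite big_split /= addnA addnC -addnn; congr (_ + (_ + _)).
rewrite deg_inE [RHS](big_setD1 x) //= adj_irr add0n.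
by apply: eq_bigr => y _; rewrite adj_sym.
Qed.

Lemma degree_sum_le_sqr W : degree_sum W <= #|W| ^ 2.
Proof.
rewrite -mulnn -sum_nat_const; apply: leq_sum => x _.
by apply/subset_leq_card/fintype.subsetP => y; rewrite inE => /andP[].
Qed.

Lemma dense_subset_min_degree (U V : {set T}) : V \subset U ->
  degree_sum U <= 2 * degree_sum V ->
  exists W, [/\ W \subset V,
    forall x, x \in W -> degree_sum U <= 8 * #|U| * deg_in W x
    & #|U| * degree_sum U <= 4 * #|U| * degree_sum W].
Proof.
move=> sVU dV; pose s := degree_sum U; pose n := #|U|.
(* [phi] is [4 n degree_sum W - s |W|] up to a constant: deleting a vertex of
   degree below [s / 8n] from [W] would increase it. *)
pose phi W := 4 * n * degree_sum W + s * (n - #|W|).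
have [W sWV maxW] :=
  @arg_maxnP _ V (fun W => W \subset V) phi (fintype.subxx V).
exists W; split=> // [x xW|].
  have sDV : W :\ x \subset V.
    by apply: fintype.subset_trans _ sWV; apply: finset.subsetDl.
  have := maxW _ sDV; rewrite /phi (degree_sumD1 xW).
  have := subset_leq_card (fintype.subset_trans sWV sVU).
  rewrite (cardsD1 x W) xW -/n -/s => le_n.
  have -> : n - #|W :\ x| = (n - (true + #|W :\ x|)).+1 by lia.
  rewrite mulnS; nia.
(* Comparison with [V] itself: since [V] keeps half of the degree sum, [phi V >= 2 n s], while the
   vertex term of [phi W] is at most [n s]. *)
have := maxW _ (fintype.subxx V); rewrite /phi -/n -/s.
have le_n : #|V| <= n := subset_leq_card sVU.
have : s * (n - #|W|) <= s * n by rewrite leq_mul2l leq_subr orbT.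
move: dV; rewrite -/s; nia.
Qed.

(** * Nearly regular subsets by repeated halving *)

Definition nearly_reg_in (k : nat) W : Prop :=
  forall x y, x \in W -> y \in W -> deg_in W x <= k * deg_in W y.

Lemma nearly_reg_in_sum0 k W : degree_sum W = 0 -> nearly_reg_in k W.
Proof.
move=> /eqP; rewrite sum_nat_eq0 => /forall_inP s0 x y xW _.
by rewrite (eqP (s0 x xW)).
Qed.

Lemma nearly_reg_step k U : 0 < degree_sum U ->
  (exists W, nearly_reg_in k W /\ #|U| <= k * #|W|) \/
  (exists V, 2 * degree_sum V < degree_sum U /\ (k - 8) * #|U| <= k * #|V|).
Proof.
move=> s_gt0; pose s := degree_sum U; pose n := #|U|.
pose H := [set x in U | k * s < 8 * n * deg_in U x].
pose V := U :\: H.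
have sVU : V \subset U by apply: finset.subsetDl.
have cardV : n = #|V| + #|H|.
  rewrite /n -(cardsID H U) addnC; congr (_ + #|pred_of_set _|).
  by apply/finset.setIidPr/fintype.subsetP => x; rewrite inE => /andP[].
(* Markov's inequality: each vertex of [H] takes more than [k s / 8n] of the total degree [s]. *)
have cardH : k * #|H| <= 8 * n.
  suff : #|H| * (k * s) <= 8 * n * s.
    by rewrite mulnA (mulnC #|H|) leq_pmul2r.
  rewrite -sum_nat_const [leqRHS]big_distrr [leqRHS](big_setID H) /=.
  rewrite -[leqLHS]addn0; apply: leq_add => //.
  rewrite (_ : U :&: H = H); last first.
    by apply/finset.setIidPr/fintype.subsetP => x; rewrite inE => /andP[].
  by apply: leq_sum => x; rewrite inE => /andP[_ /ltnW].
have [dV|dV] := leqP (degree_sum U) (2 * degree_sum V); last first.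
  by right; exists V; split=> //; rewrite -/n; nia.
left; have [W [sWV minW sumW]] := dense_subset_min_degree sVU dV.
have n_gt0 : 0 < n by have := degree_sum_le_sqr U; rewrite -/n; nia.
have maxW x : x \in W -> 8 * n * deg_in W x <= k * s.
  move=> xW; have := fintype.subsetP sWV x xW; rewrite !inE negb_and -leqNgt.
  move=> /andP[/orP[/negbTE->//|leU] _]; apply: leq_trans leU.
  by rewrite leq_mul2l deg_inS ?orbT // (fintype.subset_trans sWV).
(* All degrees in [W] lie between [s / 8n] and [k s / 8n], hence the ratio [k]. *)
exists W; split=> [x y xW yW|].
  rewrite -(@leq_pmul2l (8 * n)) ?muln_gt0 // (leq_trans (maxW x xW)) //.
  by rewrite mulnCA leq_mul2l minW ?orbT.
(* Double counting: a degree sum of at least [s / 4] with degrees at most [k s / 8n] even forces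
   [k |W| >= 2n]. *)
have : 8 * n * degree_sum W <= #|W| * (k * s).
  by rewrite /degree_sum big_distrr -sum_nat_const; apply: leq_sum.
move: sumW; rewrite -/n -/s => sumW leW.
rewrite -(leq_pmul2r s_gt0) -/s.
nia.
Qed.

(** Induction on [j]: a round that does not stop halves the degree sum at the cost of a factor
    [(k - 8) / k]. The extra factor [k] pays for the round that stops, where [|W|] may drop to
    [|U| / k]. *)
Lemma exists_nearly_reg_in k j U : 0 < k -> degree_sum U < 2 ^ j ->
  exists W, nearly_reg_in k W /\ (k - 8) ^ j * #|U| <= k ^ j.+1 * #|W|.
Proof.
move=> k_gt0; elim: j U => [|j IHj] U ltU.
  exists U; split; first by apply: nearly_reg_in_sum0; lia.
  by rewrite expn0 mul1n expn1 leq_pmull.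
have le_pow : (k - 8) ^ j.+1 <= k ^ j.+1 by rewrite leq_exp2r ?leq_subr.
have [s0|s_gt0] := posnP (degree_sum U).
  exists U; split; first exact: nearly_reg_in_sum0.
  by rewrite leq_mul2r (leq_trans le_pow) ?orbT // leq_pexp2l.
have [[W [regW leW]]|[V [ltV leV]]] := nearly_reg_step k s_gt0.
  exists W; split=> //; rewrite (leq_trans (leq_mul le_pow leW)) //.
  by rewrite mulnA -expnSr.
have [|W [regW leW]] := IHj V; first by rewrite expnS in ltU; lia.
exists W; split=> //.
rewrite expnSr -mulnA (leq_trans (leq_mul (leqnn _) leV)) //.
by rewrite mulnCA expnS -mulnA leq_mul2l leW orbT.
Qed.

(** * Passage to induced subgraphs and to the extremal functions *)

Lemma degree_induced W (x : {x : T | x \in W}) :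
  degree (induced_sgraph G W) x = deg_in W (val x).
Proof.
rewrite /degree /deg_in -(card_imset _ val_inj); apply: eq_card => y.
rewrite !inE; apply/imsetP/andP => [[z]|[yW Gxy]].
  by rewrite inE !ffunE => Gxz ->; rewrite (valP z).
by exists (Sub y yW); rewrite ?SubK // inE !ffunE SubK.
Qed.

Lemma nearly_regular_induced (R : realType) (c : R) k W : 0 < k ->
  (k%:R <= c)%R -> nearly_reg_in k W -> nearly_regular c (induced_sgraph G W).
Proof.
move=> k_gt0 le_kc regW; rewrite /nearly_regular.
set G' := induced_sgraph G W.
have le_nat : max_degree G' <= k * min_degree G'.
  apply/bigmax_leqP => x _; rewrite /min_degree.
  elim/big_ind: _ => [|m1 m2 le1 le2|y _].
  (* The default value of the minimum is the number of vertices, which bounds every degree. *)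
  - by rewrite (leq_trans (max_card _)) // leq_pmull.
  - by rewrite /minn; case: ifP.
  - by rewrite !degree_induced; apply: regW; apply: valP.
rewrite (@le_trans _ _ (k * min_degree G')%:R)%R ?ler_nat //.
by rewrite natrM ler_wpM2r.
Qed.

Lemma max_nearly_regular_ge (R : realType) (c : R) k W : 0 < k ->
  (k%:R <= c)%R -> nearly_reg_in k W -> #|W| <= max_nearly_regular G c.
Proof.
move=> k_gt0 le_kc regW; apply: leq_bigmax_cond.
exact: nearly_regular_induced regW.
Qed.

End DegreesInSubsets.

(** The hypothesis [x <= n%:R] covers the default value of the iterated minimum. *)
Lemma min_max_nearly_regular_ge (R : realType) (n : nat) (c x : R) :
  x <= n%:R -> (forall G : sgraph 'I_n, x <= (max_nearly_regular G c)%:R) ->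
  x <= (min_max_nearly_regular n c)%:R.
Proof.
move=> le_xn le_xG; rewrite /min_max_nearly_regular.
by elim/big_ind: _ => // m1 m2 le1 le2; rewrite /minn; case: ifP.
Qed.

Lemma max_nearly_regular_gt0 (R : realType) (n : nat) (c : R)
    (G : sgraph 'I_n) : (0 < n)%N -> 1 <= c -> (0 < max_nearly_regular G c)%N.
Proof.
move=> n_gt0 c_ge1; rewrite -(cards1 (Ordinal n_gt0)).
apply: (@max_nearly_regular_ge _ _ _ _ 1) => //; apply: nearly_reg_in_sum0.
rewrite /degree_sum big_set1; apply/eqP; rewrite cards_eq0 -finset.subset0.
by apply/fintype.subsetP => y; rewrite !inE => /andP[/eqP->]; rewrite adj_irr.
Qed.

Lemma max_nearly_regular_ge_expn (R : realType) (n k j : nat) (c : R)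
    (G : sgraph 'I_n) : (0 < k)%N -> k%:R <= c -> (n ^ 2 < 2 ^ j)%N ->
  ((k - 8) ^ j * n <= k ^ j.+1 * max_nearly_regular G c)%N.
Proof.
move=> k_gt0 le_kc lt_nj.
have [|W [regW leW]] := @exists_nearly_reg_in _ G k j [set: 'I_n] k_gt0.
  by rewrite (leq_ltn_trans (degree_sum_le_sqr _ _)) // cardsT card_ord.
rewrite cardsT card_ord in leW; rewrite (leq_trans leW) //.
by rewrite leq_mul2l (max_nearly_regular_ge k_gt0 le_kc regW) orbT.
Qed.

(** * Logarithmic estimates and the final bound *)

Lemma trunc_log2_le_ln (R : realType) (n : nat) : (0 < n)%N ->
  (trunc_log 2 n)%:R <= 2 * ln (n%:R : R).
Proof.
move=> n_gt0; set m := trunc_log 2 n.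
have le_pow : expR (2^-1 * m%:R) <= n%:R :> R.
  apply: (@le_trans _ _ ((2 ^ m)%:R)); last by rewrite ler_nat trunc_logP.
  rewrite mulrC expRM_natl natrX lerXn2r ?nnegrE ?expR_ge0 //.
  (* [expR (1/2) <= 2] is read off from [expR (-1/2) >= 1 - 1/2]. *)
  rewrite -[leLHS]invrK -expRN -[leRHS]invrK lef_pV2 ?posrE ?expR_gt0 //.
  by apply: le_trans (expR_ge1Dx _); lra.
have := le_pow; rewrite -(@ler_ln R) ?posrE ?expR_gt0 ?ltr0n // expRK; lra.
Qed.

(** Holds by [1 / (1 - x) <= 1 + 2x <= expR (2x)], the first step using [x <= 1/2]. It is applied to
    the loss [x = 8 / k] of one round. *)
Lemma expRN2_le1B (R : realType) (x : R) : 0 <= x <= 2^-1 ->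
  expR (- (2 * x)) <= 1 - x.
Proof.
move=> /andP[x0 x1]; rewrite expRN -[leRHS]invrK.
rewrite lef_pV2 ?posrE ?invr_gt0 ?expR_gt0 //; last lra.
apply: le_trans (expR_ge1Dx _).
rewrite -[leLHS]mul1r ler_pdivrMr; last lra.
nra.
Qed.

(** With [L = ln n], the iteration gives [ln M >= L - (16 / k) j - ln k] and [j <= 4 L + 2]. The
    term [64 L / k] is at most [128 L / K], and the lower-order rest [ln k + 32 / k] is at most
    [L / K]; hence 129. *)
Lemma powR_le_max_nearly_regular (R : realType) (n k : nat) (K : R)
    (G : sgraph 'I_n) : (0 < n)%N -> (16 <= k)%N -> k%:R <= K <= 2 * k%:R ->
  K * (ln k%:R + 32%:R / k%:R) <= ln n%:R ->
  (n%:R : R) `^ (1 - 129%:R / K) <= (max_nearly_regular G K)%:R.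
Proof.
move=> n_gt0 k_ge16 /andP[le_kK le_K2k]; set L := ln n%:R => le_L.
have k_gt0 : (0 < k)%N by apply: leq_trans k_ge16.
(* [j] is even because the degree sum may reach [n ^ 2]. *)
pose M := max_nearly_regular G K; pose j := (trunc_log 2 n).+1.*2.
have /(max_nearly_regular_ge_expn G k_gt0 le_kK) : (n ^ 2 < 2 ^ j)%N.
  by rewrite /j -mul2n mulnC expnM ltn_exp2r // trunc_log_ltn.
rewrite -/M => leM.
have kR : 16%:R <= k%:R :> R by rewrite ler_nat.
have kR_gt0 : 0 < k%:R :> R by rewrite ltr0n.
have K_gt0 : 0 < K by lra.
have L_ge0 : 0 <= L by apply: ln_ge0; rewrite ler1n.
have le_j : j%:R <= 4 * L + 2.
  by have := trunc_log2_le_ln R n_gt0; rewrite -/L /j -muln2 natrM -natr1; lra.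
have invk : 0 <= (8%:R / k%:R : R) <= 2^-1.
  by rewrite divr_ge0 //= ler_pdivrMr //; lra.
have {}leM : expR (- (16%:R / k%:R * j%:R)) * n%:R / k%:R <= M%:R :> R.
  rewrite ler_pdivrMr // mulrC (mulrC M%:R).
  apply: (@le_trans _ _ (n%:R * (1 - 8%:R / k%:R) ^+ j)).
    rewrite ler_wpM2l // -mulNr mulrC expRM_natl lerXn2r ?nnegrE ?expR_ge0 //.
      by lra.
    by apply: le_trans (expRN2_le1B invk); rewrite ler_expR; lra.
  have -> : 1 - 8%:R / k%:R = (k - 8)%:R / k%:R :> R.
    by rewrite natrB ?(leq_trans _ k_ge16) // mulrBl divff // gt_eqF.
  rewrite exprMn exprVn mulrA ler_pdivrMr ?exprn_gt0 // -!natrX -!natrM ler_nat.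
  by move: leM; rewrite expnSr; lia.
apply: le_trans leM.
rewrite /powR gt_eqF ?ltr0n // -/L.
rewrite -(@lnK _ n%:R) ?posrE ?ltr0n // -/L -{2}(@lnK _ k%:R) ?posrE //.
rewrite -expRN -!expRD ler_expR.
have le_16j : 16%:R / k%:R * j%:R <= 16%:R / k%:R * (4 * L + 2).
  by rewrite ler_wpM2l // divr_ge0.
have le_64L : 64%:R / k%:R * L <= 128%:R / K * L.
  by rewrite ler_wpM2r // ler_pdivrMr // mulrAC ler_pdivlMr //; lra.
have {}le_L : ln k%:R + 32%:R / k%:R <= L / K.
  by rewrite ler_pdivlMr // mulrC.
lra.
Qed.

Theorem proposition1p1 (R : realType) :
  exists b : R, 0 < b /\
    forall K : R, 21%:R / 10%:R <= K ->
      exists n0 : nat, forall n : nat, (n0 <= n)%N ->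
        (n%:R : R) `^ (1 - b / K) <= (min_max_nearly_regular n K)%:R.
Proof.
exists 129%:R; split=> // K K_ge.
have K_gt0 : 0 < K by lra.
pose k := Num.truncn K.
(* Chosen so that [ln n] absorbs the lower-order terms once [n >= n0]. *)
pose n0 := (Num.truncn (expR (K * (ln k%:R + 32%:R / k%:R)))).+1.
exists n0 => n le_n; have n_gt0 : (0 < n)%N by apply: leq_trans le_n.
have n_ge1 : 1 <= n%:R :> R by rewrite ler1n.
apply: min_max_nearly_regular_ge => [|G].
  rewrite -[leRHS]powRr1 ?ler0n // ler_powR //.
  by rewrite gerBl divr_ge0 // ltW.
(* For [K < 129] the exponent is negative, so a single vertex suffices; otherwise [k >= 16] and
   [K <= 2 k]. *)
have [K_lt|K_ge129] := ltP K 129%:R.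
  apply: (@le_trans _ _ 1); last first.
    by rewrite ler1n max_nearly_regular_gt0 //; lra.
  rewrite -[leRHS](powRr0 n%:R) ler_powR // subr_le0.
  by rewrite ler_pdivlMr // mul1r ltW.
have /andP[le_kK lt_Kk] := truncn_itv (ltW K_gt0).
have k_ge : (16 <= k)%N.
  by rewrite -ltnS -(ltr_nat R); apply: le_lt_trans lt_Kk; lra.
have kR : 16%:R <= k%:R :> R by rewrite ler_nat.
apply: (@powR_le_max_nearly_regular _ _ k) => //.
  by rewrite le_kK /=; move: lt_Kk; rewrite -natr1 -/k; lra.
rewrite -ler_expR lnK ?posrE ?ltr0n //.
apply: (@le_trans _ _ n0%:R); last by rewrite ler_nat.
by rewrite ltW // truncnS_gt.
Qed.
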